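(* Let $\mathcal{A}$ be a semi-abelian category with enough (regular) projectives. Then a morphism of the category $\mathcal{S}\mathcal{A}$ of simplicial objects in $\mathcal{A}$ is a weak equivalence if and only if it is a homology isomorphism.
   Context: A semi-abelian category is a category that is pointed (has a zero object), Barr exact (regular, i.e. finitely complete with coequalizers of kernel pairs and pullback-stable regular epimorphisms, and such that every internal equivalence relation is a kernel pair), Bourn protomodular (in this pointed regular context: the Short Five Lemma holds for regular epimorphisms and their kernels), and has binary coproducts. Such a category is finitely cocomplete. An object $P$ is (regular) projective if $\mathrm{Hom}(P,\cdot)$ sends regular epimorphisms to surjections; enough projectives means that every object is the codomain of a regular epimorphism with projective domain. Homology. $K[f]$ denotes the kernel object of $f$ and $\ker f$ its inclusion; $[n]=\{0,\dots,n\}$. A simplicial object $A$ has faces $\partial_i\colon A_n\to A_{n-1}$ and degeneracies $\sigma_i\colon A_n\to A_{n+1}$, $i\in[n]$. Its Moore complex $N(A)$ is the chain complex with $N_0A=A_0$, $N_nA=\bigcap_{i=0}^{n-1}K[\partial_i\colon A_n\to A_{n-1}]$ for $n\geq1$, $N_nA=0$ for $n<0$, and differential $d_n\colon N_nA\to N_{n-1}A$, $n\ge1$, induced by the restriction of $\partial_n$. For $n\in\mathbb{N}$, the homology object $H_nA$ is the cokernel of the factorization $d'_{n+1}\colon N_{n+1}A\to K[d_n]$ of $d_{n+1}$ through the kernel of $d_n$ (where $K[d_0]=A_0$). A homology isomorphism is a morphism $f$ in $\mathcal{S}\mathcal{A}$ such that $H_nf$ is an isomorphism for every $n\in\mathbb{N}$.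 Weak equivalences. For a simplicial object $A$ and an object $P$, $\mathrm{Hom}(P,A)$ is the simplicial set with $\mathrm{Hom}(P,A)_n=\mathrm{Hom}(P,A_n)$; for $P$ projective it is a Kan complex. A morphism $f\colon A\to B$ in $\mathcal{S}\mathcal{A}$ is a weak equivalence if for every projective $P$ the map $\mathrm{Hom}(P,f)$ is a weak equivalence of simplicial sets, that is, for all $n\in\mathbb{N}$ and all $x\in\mathrm{Hom}(P,A_0)$ it induces an isomorphism (bijection for $n=0$) $\pi_n(\mathrm{Hom}(P,A),x)\to\pi_n(\mathrm{Hom}(P,B),f_0\circ x)$. The homotopy groups of a Kan simplicial set $K$ at $x\in K_0$ are defined as follows. Let $Z_0(K,x)=K_0$ and, for $n\geq1$, $Z_n(K,x)=\{z\in K_n\mid \partial_i(z)=x \text{ for } i\in[n]\}$, where $x$ also denotes its iterated degeneracies $(\sigma_0\circ\cdots\circ\sigma_0)(x)$. Elements $z,z'\in Z_n(K,x)$ are homotopic, $z\sim z'$, if there is $y\in K_{n+1}$ with $\partial_i(y)=x$ for $i<n$, $\partial_n(y)=z$ and $\partial_{n+1}(y)=z'$. This is an equivalence relation and $\pi_n(K,x)=Z_n(K,x)/{\sim}$. *)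

(* Defs.v *)
From mathcomp Require Import all_boot.
From mathcomp Require Import boolp.

Set Implicit Arguments.
Unset Strict Implicit.
Unset Printing Implicit Defensive.

Declare Scope cat_scope.
Delimit Scope cat_scope with cat.
Local Open Scope cat_scope.

Record category := Category {
  ob :> Type;
  hom : ob -> ob -> Type;
  idm : forall X, hom X X;
  comp : forall X Y Z, hom Y Z -> hom X Y -> hom X Z;
  comp1m : forall X Y (f : hom X Y), comp (idm Y) f = f;
  compm1 : forall X Y (f : hom X Y), comp f (idm X) = f;
  compA : forall W X Y Z (h : hom Y Z) (g : hom X Y) (f : hom W X),
    comp h (comp g f) = comp (comp h g) f }.

Arguments hom {c} X Y.
Arguments idm {c} X.
Arguments comp {c X Y Z} g f.

Notation "g ∘ f" := (comp g f) (at level 40, left associativity) : cat_scope.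

Section Notions.
Variable C : category.
Implicit Types X Y Z K P R S T : C.

Definition is_iso X Y (f : hom X Y) : Prop :=
  exists g : hom Y X, g ∘ f = idm X /\ f ∘ g = idm Y.

Definition mono X Y (m : hom X Y) : Prop :=
  forall T (a b : hom T X), m ∘ a = m ∘ b -> a = b.

Definition is_terminal Z : Prop := forall X, exists! f : hom X Z, True.
Definition is_initial Z : Prop := forall X, exists! f : hom Z X, True.
Definition is_zero Z : Prop := is_terminal Z /\ is_initial Z.
Definition pointed : Prop := exists Z, is_zero Z.

Definition zero_morph X Y (f : hom X Y) : Prop :=
  exists Z, is_zero Z /\ exists (u : hom X Z) (v : hom Z Y), f = v ∘ u.

(* Diagrams are indexed by finite graphs: a functor on a finite category has
   the same cones as its underlying graph morphism. *)
Record diagram := Diagram {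
  vertex : finType;
  edge : finType;
  src : edge -> vertex;
  tgt : edge -> vertex;
  dob : vertex -> C;
  dmor : forall e, hom (dob (src e)) (dob (tgt e)) }.

Definition is_cone (D : diagram) L (p : forall v, hom L (dob (d := D) v)) :=
  forall e, dmor e ∘ p (src e) = p (tgt e).

Definition is_limit (D : diagram) L (p : forall v, hom L (dob (d := D) v)) :=
  is_cone p /\
  forall T (q : forall v, hom T (dob v)), is_cone q ->
    exists! h : hom T L, forall v, p v ∘ h = q v.

Definition finitely_complete : Prop :=
  forall D : diagram, exists L (p : forall v, hom L (dob (d := D) v)), is_limit p.

Definition is_pullback X Y Z P (f : hom X Z) (g : hom Y Z)
    (p : hom P X) (q : hom P Y) : Prop :=
  f ∘ p = g ∘ q /\
  forall T (u : hom T X) (v : hom T Y), f ∘ u = g ∘ v ->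
    exists! h : hom T P, p ∘ h = u /\ q ∘ h = v.

Definition is_kernel_pair X Y R (f : hom X Y) (r1 r2 : hom R X) : Prop :=
  is_pullback f f r1 r2.

Definition is_coequalizer X Y Q (f g : hom X Y) (q : hom Y Q) : Prop :=
  q ∘ f = q ∘ g /\
  forall T (h : hom Y T), h ∘ f = h ∘ g -> exists! k : hom Q T, k ∘ q = h.

Definition regular_epi X Y (e : hom X Y) : Prop :=
  exists W (f g : hom W X), is_coequalizer f g e.

Definition is_kernel X Y K (f : hom X Y) (k : hom K X) : Prop :=
  zero_morph (f ∘ k) /\
  forall T (g : hom T X), zero_morph (f ∘ g) ->
    exists! h : hom T K, k ∘ h = g.

Definition is_cokernel X Y Q (f : hom X Y) (q : hom Y Q) : Prop :=
  zero_morph (q ∘ f) /\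
  forall T (g : hom Y T), zero_morph (g ∘ f) ->
    exists! h : hom Q T, h ∘ q = g.

Definition is_intersection (I : Type) X (S : I -> C)
    (m : forall i, hom (S i) X) L (l : hom L X) : Prop :=
  (forall i, exists h, m i ∘ h = l) /\
  forall T (g : hom T X), (forall i, exists h, m i ∘ h = g) ->
    exists! h : hom T L, l ∘ h = g.

Definition is_coproduct X Y S (i1 : hom X S) (i2 : hom Y S) : Prop :=
  forall T (f : hom X T) (g : hom Y T),
    exists! h : hom S T, h ∘ i1 = f /\ h ∘ i2 = g.

Definition regular : Prop :=
  [/\ finitely_complete,
      forall X Y R (f : hom X Y) (r1 r2 : hom R X), is_kernel_pair f r1 r2 ->
        exists Q (q : hom X Q), is_coequalizer r1 r2 q
    & forall X Y Z P (f : hom X Z) (g : hom Y Z) (p : hom P X) (q : hom P Y),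
        is_pullback f g p q -> regular_epi f -> regular_epi q].

Definition internal_equivalence X R (r1 r2 : hom R X) : Prop :=
  [/\ forall T (a b : hom T R), r1 ∘ a = r1 ∘ b -> r2 ∘ a = r2 ∘ b -> a = b,
      exists s : hom X R, r1 ∘ s = idm X /\ r2 ∘ s = idm X,
      exists s : hom R R, r1 ∘ s = r2 /\ r2 ∘ s = r1
    & forall P (p1 p2 : hom P R), is_pullback r2 r1 p1 p2 ->
        exists t : hom P R, r1 ∘ t = r1 ∘ p1 /\ r2 ∘ t = r2 ∘ p2].

Definition barr_exact : Prop :=
  regular /\
  forall X R (r1 r2 : hom R X), internal_equivalence r1 r2 ->
    exists Y (f : hom X Y), is_kernel_pair f r1 r2.

Definition protomodular : Prop :=
  forall K X Y K' X' Y'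
    (k : hom K X) (p : hom X Y) (k' : hom K' X') (p' : hom X' Y')
    (u : hom K K') (v : hom X X') (w : hom Y Y'),
  regular_epi p -> regular_epi p' -> is_kernel p k -> is_kernel p' k' ->
  v ∘ k = k' ∘ u -> w ∘ p = p' ∘ v ->
  is_iso u -> is_iso w -> is_iso v.

Definition has_binary_coproducts : Prop :=
  forall X Y, exists S (i1 : hom X S) (i2 : hom Y S), is_coproduct i1 i2.

Definition projective P : Prop :=
  forall X Y (e : hom X Y), regular_epi e ->
    forall g : hom P Y, exists h : hom P X, e ∘ h = g.

Definition enough_projectives : Prop :=
  forall X, exists P (e : hom P X), projective P /\ regular_epi e.

End Notions.

Record semi_abelian (C : category) : Prop := SemiAbelian {
  sa_pointed : pointed C;
  sa_exact : barr_exact C;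
  sa_protomodular : protomodular C;
  sa_coproducts : has_binary_coproducts C }.

Section Existence.
Variables (C : category) (saC : semi_abelian C).
Implicit Types X Y Z K P R S T : C.

Lemma zero_morph_ex X Y : exists z : hom X Y, zero_morph z.
Proof.
have [Z zZ] := sa_pointed saC.
have [u _] := zZ.1 X; have [v _] := zZ.2 Y.
by exists (v ∘ u), Z; split=> //; exists u, v.
Qed.

Lemma zero_morph_through X Y Z (f : hom X Y) : is_zero Z -> zero_morph f ->
  exists (u : hom X Z) (v : hom Z Y), f = v ∘ u.
Proof.
move=> zZ [Z' [zZ' [u [v ->]]]].
have [a _] := zZ.1 Z'; have [b _] := zZ.2 Z'.
exists (a ∘ u), (v ∘ b); rewrite -compA (compA b).
have [c [_ cU]] := zZ'.1 Z'.
by rewrite -(cU (b ∘ a) I) (cU (idm Z') I) comp1m.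
Qed.

Lemma zero_morph_eq X Y (f g : hom X Y) :
  zero_morph f -> zero_morph g -> f = g.
Proof.
move=> zf zg; have [Z zZ] := sa_pointed saC.
have [u [v ->]] := zero_morph_through zZ zf.
have [u' [v' ->]] := zero_morph_through zZ zg.
have [c [_ cU]] := zZ.1 X; have [d [_ dU]] := zZ.2 Y.
by rewrite -(cU u I) -(cU u' I) -(dU v I) -(dU v' I).
Qed.

Lemma zero_morphl X Y Z (f : hom X Y) (g : hom Y Z) :
  zero_morph f -> zero_morph (g ∘ f).
Proof.
move=> [W [zW [u [v ->]]]].
by exists W; split=> //; exists u, (g ∘ v); rewrite compA.
Qed.

Lemma zero_morphr X Y Z (f : hom X Y) (g : hom Y Z) :
  zero_morph g -> zero_morph (g ∘ f).
Proof.
move=> [W [zW [u [v ->]]]].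
by exists W; split=> //; exists (u ∘ f), v; rewrite compA.
Qed.

Lemma coequalizer_epi W X Y T (f g : hom W X) (q : hom X Y) (a b : hom Y T) :
  is_coequalizer f g q -> a ∘ q = b ∘ q -> a = b.
Proof.
move=> [qfg qU] abq.
have [|k [_ kU]] := qU T (a ∘ q); first by rewrite -!compA qfg.
by rewrite -(kU a erefl) (kU b).
Qed.

Lemma regular_epi_epi X Y T (q : hom X Y) (a b : hom Y T) :
  regular_epi q -> a ∘ q = b ∘ q -> a = b.
Proof. by move=> [W [f [g fgq]]]; apply: coequalizer_epi fgq. Qed.

Lemma kernel_mono X Y K (f : hom X Y) (k : hom K X) :
  is_kernel f k -> mono k.
Proof.
move=> [zk kU] T a b kab.
have [|h [_ hU]] := kU T (k ∘ a); first by rewrite compA; apply: zero_morphr.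
by rewrite -(hU a erefl) (hU b).
Qed.

Lemma pullback_mono_eq X Y Z P (f : hom X Z) (g : hom Y Z)
    (p : hom P X) (q : hom P Y) T (a b : hom T P) : is_pullback f g p q ->
  p ∘ a = p ∘ b -> q ∘ a = q ∘ b -> a = b.
Proof.
move=> [fg pqU] pab qab.
have [|h [_ hU]] := pqU T (p ∘ a) (q ∘ a); first by rewrite !compA fg.
by rewrite -(hU a) // -(hU b).
Qed.

Lemma pullback_sym X Y Z P (f : hom X Z) (g : hom Y Z)
    (p : hom P X) (q : hom P Y) : is_pullback f g p q -> is_pullback g f q p.
Proof.
move=> [fg pqU]; split=> // T u v uv.
have [h [[ph qh] hU]] := pqU T v u (esym uv).
by exists h; split=> // h' [? ?]; apply: hU.
Qed.

Definition star_diagram (I : finType) Z (B : I -> C) (g : forall i, hom (B i) Z)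
  : diagram C :=
  @Diagram C (option I) I (fun i => Some i) (fun=> None)
    (fun o => if o is Some i then B i else Z) g.

Lemma wide_pullback_ex (I : finType) Z (B : I -> C)
    (g : forall i, hom (B i) Z) :
  exists L (l : hom L Z) (p : forall i, hom L (B i)),
    (forall i, g i ∘ p i = l) /\
    forall T (u : hom T Z) (q : forall i, hom T (B i)),
      (forall i, g i ∘ q i = u) ->
      exists! h : hom T L, l ∘ h = u /\ forall i, p i ∘ h = q i.
Proof.
have [[fc _ _] _] := sa_exact saC.
have [L [p [pcone pU]]] := fc (star_diagram g).
exists L, (p None), (fun i => p (Some i)); split=> [i|T u q gq].
  exact: pcone i.
pose q' o : hom T (dob (d := star_diagram g) o) :=
  if o is Some i then q i else u.
have [|h [hq hU]] := pU T q'; first by move=> i; apply: gq.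
exists h; split=> [|h' [hN hS]].
  by split=> [|i]; [exact: hq None | exact: hq (Some i)].
by apply: hU => -[i|]; [exact: hS | exact: hN].
Qed.

Lemma pullback_ex X Y Z (f : hom X Z) (g : hom Y Z) :
  exists P (p : hom P X) (q : hom P Y), is_pullback f g p q.
Proof.
pose B (b : bool) := if b then X else Y.
pose F (b : bool) : hom (B b) Z :=
  if b as b0 return hom (B b0) Z then f else g.
have [L [l [p [pl pU]]]] := wide_pullback_ex F.
exists L, (p true), (p false); split=> [|T u v uv].
  by rewrite (pl true : f ∘ _ = _) (pl false : g ∘ _ = _).
pose Q (b : bool) : hom T (B b) :=
  if b as b0 return hom T (B b0) then u else v.
have [|h [[lh ph] hU]] := pU T (f ∘ u) Q; first by case.
exists h; split; first by split; [exact: ph true | exact: ph false].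
move=> h' [h'1 h'2]; apply: hU; split; last by case.
by rewrite -(pl true) -h'1 compA.
Qed.

Lemma product_ex X Y : exists P (p : hom P X) (q : hom P Y),
  forall T (u : hom T X) (v : hom T Y),
    exists! h : hom T P, p ∘ h = u /\ q ∘ h = v.
Proof.
have [Z zZ] := sa_pointed saC.
have [f _] := zZ.1 X; have [g _] := zZ.1 Y.
have [P [p [q [_ pqU]]]] := pullback_ex f g.
exists P, p, q => T u v; apply: pqU.
by have [c [_ cU]] := zZ.1 T; rewrite -(cU (f ∘ u) I) -(cU (g ∘ v) I).
Qed.

Lemma kernel_ex X Y (f : hom X Y) : exists K (k : hom K X), is_kernel f k.
Proof.
have [Z zZ] := sa_pointed saC; have [z _] := zZ.2 Y.
have [K [k [q [fk kU]]]] := pullback_ex f z.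
exists K, k; split; first by exists Z; split=> //; exists q, z.
move=> T g zg; have [u [v fg]] := zero_morph_through zZ zg.
have [w [_ wU]] := zZ.2 Y.
have [|h [[kh qh] hU]] := kU T g u; first by rewrite fg -(wU v I) (wU z I).
exists h; split=> // h' kh'; apply: hU; split=> //.
by have [c [_ cU]] := zZ.1 T; rewrite -(cU (q ∘ h') I) -(cU u I).
Qed.

Lemma intersection_ex (I : finType) X (S : I -> C) (m : forall i, hom (S i) X) :
  (forall i, mono (m i)) -> exists L (l : hom L X), is_intersection m l.
Proof.
move=> mm; have [L [l [p [pl pU]]]] := wide_pullback_ex m.
exists L, l; split=> [i|T g gm]; first by exists (p i).
pose q i := sval (cid (gm i)).
have qP i : m i ∘ q i = g by rewrite /q; case: cid.
have [h [[lh ph] hU]] := pU T g q qP.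
exists h; split=> // h' lh'; apply: hU; split=> // i.
by apply: mm; rewrite compA pl lh'.
Qed.

Lemma image_ex X Y (f : hom X Y) : exists M (e : hom X M) (m : hom M Y),
  [/\ regular_epi e, mono m & f = m ∘ e].
Proof.
have [[_ kpq stab] _] := sa_exact saC.
have [R [p1 [p2 kp]]] := pullback_ex f f.
have [M [e eq]] := kpq _ _ _ _ _ _ kp.
have [m [me _]] := eq.2 Y f kp.1.
have re : regular_epi e by exists R, p1, p2.
exists M, e, m; split=> // T a b mab.
have [P1 [x1 [u1 pb1]]] := pullback_ex e a.
have [P2 [x2 [u2 pb2]]] := pullback_ex e (b ∘ u1).
have re1 := stab _ _ _ _ _ _ _ _ pb1 re.
have re2 := stab _ _ _ _ _ _ _ _ pb2 re.
apply: (regular_epi_epi re1); apply: (regular_epi_epi re2).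
rewrite -pb1.1 -pb2.1.
have [|h [[h1 h2] _]] := kp.2 P2 (x1 ∘ u2) x2.
  by rewrite -me -!compA pb2.1 (compA e) pb1.1 !compA mab.
by rewrite -h2 -compA -h1 !compA eq.1.
Qed.

Lemma split_epi_regular X Y (p : hom X Y) (s : hom Y X) :
  p ∘ s = idm Y -> regular_epi p.
Proof.
move=> ps; exists X, (idm X), (s ∘ p); split.
  by rewrite compm1 compA ps comp1m.
move=> T h; rewrite compm1 => hE; exists (h ∘ s); split.
  by rewrite -compA.
by move=> k <-; rewrite -compA ps compm1.
Qed.

(* Protomodularity makes every reflexive relation an equivalence relation. *)
Lemma reflexive_euclidean X P R (p q : hom P X) (m : hom R P) (s : hom X R) :
  (forall T (u v : hom T X), exists! h : hom T P, p ∘ h = u /\ q ∘ h = v) ->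
  mono m -> p ∘ m ∘ s = idm X -> q ∘ m ∘ s = idm X ->
  forall T (a b : hom T R), p ∘ m ∘ a = p ∘ m ∘ b ->
    exists c : hom T R, p ∘ m ∘ c = q ∘ m ∘ a /\ q ∘ m ∘ c = q ∘ m ∘ b.
Proof.
move=> prod mm ps qs.
have prod_eq T (a b : hom T P) : p ∘ a = p ∘ b -> q ∘ a = q ∘ b -> a = b.
  move=> pab qab; have [h [_ hU]] := prod T (p ∘ a) (q ∘ a).
  by rewrite -(hU a) // -(hU b).
have [U [t1 [t2 pbU]]] := pullback_ex (p ∘ m) (p ∘ m).
have [w [[pw qw] _]] := prod U (q ∘ m ∘ t1) (q ∘ m ∘ t2).
have [V [t3 [j pbV]]] := pullback_ex m w.
have [d [[d1 d2] _]] := pbU.2 R (idm R) (idm R) erefl.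
have [|d' [[d'3 d'j] _]] := pbV.2 R (s ∘ (q ∘ m)) d.
  apply: prod_eq; rewrite !compA ?pw ?qw ?ps ?qs comp1m -!compA ?d1 ?d2.
    by rewrite compm1.
  by rewrite compm1.
have jmono : mono j.
  move=> T a b jab; apply: (pullback_mono_eq pbV) => //.
  by apply: mm; rewrite !compA pbV.1 -!compA jab.
have [K [k kerk]] := kernel_ex t1.
have [K' [k' kerk']] := kernel_ex (t1 ∘ j).
have [|u [ku _]] := kerk.2 K' (j ∘ k').
  by rewrite compA; exact: kerk'.1.
have [|v [[v3 vj] _]] := pbV.2 K (t2 ∘ k) k.
  apply: prod_eq; rewrite !compA ?pw ?qw //.
  rewrite -pbU.1 -!compA.
  by apply: zero_morph_eq; do 2?apply: zero_morphl; exact: kerk.1.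
have [|v' [kv' _]] := kerk'.2 K v; first by rewrite -compA vj; exact: kerk.1.
have isou : is_iso u.
  have uv : u ∘ v' = idm K.
    by apply: (kernel_mono kerk); rewrite compA ku -compA kv' vj compm1.
  exists v'; split=> //; apply: (kernel_mono kerk'); apply: jmono.
  by rewrite !compA -ku -(compA k u) uv compm1 compm1.
have [ji [jij jji]] : is_iso j.
  apply: (sa_protomodular saC (p := t1 ∘ j) (p' := t1) (k := k') (k' := k)
            (u := u) (w := idm R)) => //.
  - by apply: (@split_epi_regular _ _ _ d'); rewrite -compA d'j.
  - exact: (@split_epi_regular _ _ _ d).
  - by rewrite comp1m.
  - by exists (idm R); rewrite comp1m.
move=> T a b ab; have [h [[h1 h2] _]] := pbU.2 T a b ab.
have mt3 : m ∘ (t3 ∘ ji) = w by rewrite compA pbV.1 -compA jji compm1.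
exists (t3 ∘ ji ∘ h); rewrite -!(compA _ m) (compA m) mt3 -h1 -h2.
by rewrite !compA pw qw.
Qed.

Lemma coequalizer_of_reflexive X R (r1 r2 : hom R X) (s : hom X R) :
  (forall T (a b : hom T R), r1 ∘ a = r1 ∘ b -> r2 ∘ a = r2 ∘ b -> a = b) ->
  r1 ∘ s = idm X -> r2 ∘ s = idm X ->
  exists Q (q : hom X Q), is_coequalizer r1 r2 q.
Proof.
move=> rmono r1s r2s; have [[_ kpq _] eff] := sa_exact saC.
have [P [p [q prod]]] := product_ex X X.
have [m [[pm qm] _]] := prod R r1 r2.
have mm : mono m.
  by move=> T a b mab; apply: rmono; rewrite -?pm -?qm -!compA mab.
have euc T (a b : hom T R) : r1 ∘ a = r1 ∘ b ->
    exists c : hom T R, r1 ∘ c = r2 ∘ a /\ r2 ∘ c = r2 ∘ b.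
  move=> ab; have := @reflexive_euclidean X P R p q m s prod mm.
  by rewrite pm qm; apply.
suff /eff[Y [f kp]] : internal_equivalence r1 r2 by apply: kpq kp.
have [|sy [sy1 sy2]] := euc R (idm R) (s ∘ r1).
  by rewrite compm1 compA r1s comp1m.
rewrite compm1 in sy1; rewrite compA r2s comp1m in sy2.
split=> //; [by exists s | by exists sy |].
move=> T p1 p2 [p12 _]; have [|c [c1 c2]] := euc T (sy ∘ p1) p2.
  by rewrite compA sy1.
by exists c; rewrite c1 compA sy2.
Qed.

Lemma cokernel_ex X Y (f : hom X Y) : exists Q (q : hom Y Q), is_cokernel f q.
Proof.
have [S [i1 [i2 cop]]] := sa_coproducts saC X Y.
have [z zz] := zero_morph_ex X Y.
have [a [[a1 a2] _]] := cop Y f (idm Y).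
have [b [[b1 b2] _]] := cop Y z (idm Y).
have [P [p [q prod]]] := product_ex Y Y.
have [ab [[pab qab] _]] := prod S a b.
have [R [e [m [re mm abE]]]] := image_ex ab.
have prod_eq T (x y : hom T P) : p ∘ x = p ∘ y -> q ∘ x = q ∘ y -> x = y.
  move=> pxy qxy; have [h [_ hU]] := prod T (p ∘ x) (q ∘ x).
  by rewrite -(hU x) // -(hU y).
have aE : a = p ∘ m ∘ e by rewrite -compA -abE.
have bE : b = q ∘ m ∘ e by rewrite -compA -abE.
have [Q [c [ceq cU]]] : exists Q (c : hom Y Q),
    is_coequalizer (p ∘ m) (q ∘ m) c.
  apply: (@coequalizer_of_reflexive _ _ _ _ (e ∘ i2)).
  - move=> T x y; rewrite -!compA => px qx.
    by apply: mm; apply: prod_eq.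
  - by rewrite compA -aE.
  - by rewrite compA -bE.
exists Q, c; split.
  have -> : c ∘ f = c ∘ z; last exact: zero_morphl.
  by rewrite -a1 -b1 aE bE (compA c _ i1) (compA c _ e) ceq -!compA.
move=> T g zg; apply: cU.
apply: (regular_epi_epi re); rewrite -!compA -abE pab qab.
have [k [_ kU]] := cop T (g ∘ f) g.
rewrite -(kU (g ∘ a)); last by rewrite -!compA a1 a2 compm1.
apply: kU; rewrite -!compA b1 b2 compm1; split=> //.
by apply: zero_morph_eq => //; apply: zero_morphl.
Qed.

Definition ker_ob X Y (f : hom X Y) : C := sval (cid (kernel_ex f)).
Definition ker_mor X Y (f : hom X Y) : hom (ker_ob f) X :=
  sval (cid (svalP (cid (kernel_ex f)))).
Lemma ker_morP X Y (f : hom X Y) : is_kernel f (ker_mor f).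
Proof. exact: svalP (cid (svalP (cid (kernel_ex f)))). Qed.

Definition coker_ob X Y (f : hom X Y) : C := sval (cid (cokernel_ex f)).
Definition coker_mor X Y (f : hom X Y) : hom Y (coker_ob f) :=
  sval (cid (svalP (cid (cokernel_ex f)))).
Lemma coker_morP X Y (f : hom X Y) : is_cokernel f (coker_mor f).
Proof. exact: svalP (cid (svalP (cid (cokernel_ex f)))). Qed.

Lemma ker_mono X Y (f : hom X Y) : mono (ker_mor f).
Proof. exact: kernel_mono (ker_morP f). Qed.

Section KernelsIntersection.
Variables (I : finType) (X : C) (Y : I -> C) (f : forall i, hom X (Y i)).

Let inter_ex := intersection_ex (fun i => ker_mono (f := f i)).

Definition inter_ker_ob : C := sval (cid inter_ex).
Definition inter_ker_mor : hom inter_ker_ob X :=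
  sval (cid (svalP (cid inter_ex))).
Lemma inter_ker_morP :
  is_intersection (fun i => ker_mor (f i)) inter_ker_mor.
Proof. exact: svalP (cid (svalP (cid inter_ex))). Qed.

Lemma inter_ker_zero i : zero_morph (f i ∘ inter_ker_mor).
Proof.
have [h <-] := inter_ker_morP.1 i.
by rewrite compA; apply: zero_morphr; exact: (ker_morP (f i)).1.
Qed.

Lemma inter_ker_lift T (g : hom T X) : (forall i, zero_morph (f i ∘ g)) ->
  exists h, inter_ker_mor ∘ h = g.
Proof.
move=> zg; have [|h [hE _]] := inter_ker_morP.2 T g; last by exists h.
by move=> i; have [h [hE _]] := (ker_morP (f i)).2 T g (zg i); exists h.
Qed.

End KernelsIntersection.

End Existence.

(* The simplicial identities, with [widen_ord] and [lift ord0] standing for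
   i |-> i and i |-> i + 1; indices are shifted so that no predecessor
   appears, e.g. d_i d_j = d_(j-1) d_i (i < j) reads
   d_i d_(j+1) = d_j d_i (i <= j). *)
Definition keep n (i : 'I_n) : 'I_n.+1 := widen_ord (leqnSn n) i.
Definition next n (i : 'I_n) : 'I_n.+1 := lift ord0 i.

Record simplicial (C : category) := Simplicial {
  sob :> nat -> C;
  face : forall n, 'I_n.+2 -> hom (sob n.+1) (sob n);
  degen : forall n, 'I_n.+1 -> hom (sob n) (sob n.+1);
  face_face : forall n (i j : 'I_n.+2), i <= j ->
    face i ∘ face (next j) = face j ∘ face (keep i);
  degen_degen : forall n (i j : 'I_n.+1), i <= j ->
    degen (next j) ∘ degen i = degen (keep i) ∘ degen j;
  face_degen_lt : forall n (i : 'I_n.+2) (j : 'I_n.+1), i <= j ->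
    face (keep i) ∘ degen (next j) = degen j ∘ face i;
  face_degen_eq : forall n (j : 'I_n.+1), face (keep j) ∘ degen j = idm (sob n);
  face_degen_eqS : forall n (j : 'I_n.+1), face (next j) ∘ degen j = idm (sob n);
  face_degen_gt : forall n (i : 'I_n.+2) (j : 'I_n.+1), j < i ->
    face (next i) ∘ degen (keep j) = degen j ∘ face i }.

Arguments face {C} s {n} i.
Arguments degen {C} s {n} i.

Record simplicial_map (C : category) (A B : simplicial C) := SimplicialMap {
  smap :> forall n, hom (A n) (B n);
  smap_face : forall n (i : 'I_n.+2),
    smap n ∘ face A i = face B i ∘ smap n.+1;
  smap_degen : forall n (i : 'I_n.+1),
    smap n.+1 ∘ degen A i = degen B i ∘ smap n }.

Section Homology.
Variables (C : category) (saC : semi_abelian C).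

Section Complex.
Variable A : simplicial C.

Definition moore_ob (n : nat) : C :=
  if n is n'.+1 then
    inter_ker_ob saC (fun i : 'I_n'.+1 => face A (keep i))
  else A 0.

Definition moore_incl (n : nat) : hom (moore_ob n) (A n) :=
  if n is n'.+1 then
    inter_ker_mor saC (fun i : 'I_n'.+1 => face A (keep i))
  else idm (A 0).

Lemma moore_incl_mono n : mono (moore_incl n).
Proof.
case: n => [|n] T a b; first by rewrite !comp1m.
move=> ab; have P := inter_ker_morP saC (fun i : 'I_n.+1 => face A (keep i)).
have [|h [_ hU]] := P.2 T (moore_incl n.+1 ∘ a).
  by move=> i; have [h hE] := P.1 i; exists (h ∘ a); rewrite compA hE.
by rewrite -(hU a erefl) (hU b (esym ab)).
Qed.

Lemma moore_diff_ex n : exists d : hom (moore_ob n.+1) (moore_ob n),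
  moore_incl n ∘ d = face A ord_max ∘ moore_incl n.+1.
Proof.
case: n => [|n]; first by exists (face A ord_max ∘ moore_incl 1); apply: comp1m.
apply: inter_ker_lift => i; rewrite compA.
have -> : ord_max = next (@ord_max n.+1) by apply: val_inj.
rewrite face_face; last exact: leq_ord.
by rewrite -compA; apply: (zero_morphl _ (inter_ker_zero _ _ (keep i))).
Qed.

(* the differential d_(n+1) *)
Definition moore_diff n : hom (moore_ob n.+1) (moore_ob n) :=
  sval (cid (moore_diff_ex n)).

Lemma moore_diffP n :
  moore_incl n ∘ moore_diff n = face A ord_max ∘ moore_incl n.+1.
Proof. exact: svalP (cid (moore_diff_ex n)). Qed.

Lemma moore_diff_diff n : zero_morph (moore_diff n ∘ moore_diff n.+1).
Proof.
have [z zz] := zero_morph_ex saC (moore_ob n.+2) (moore_ob n).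
rewrite (moore_incl_mono (a := moore_diff n ∘ moore_diff n.+1) (b := z)) //.
apply: (zero_morph_eq saC); last exact: zero_morphl.
rewrite compA moore_diffP -compA moore_diffP compA.
have -> : @ord_max n.+2 = next ord_max by apply: val_inj.
rewrite face_face // -compA.
exact: (zero_morphl _ (inter_ker_zero saC _ ord_max)).
Qed.

(* K[d_n], with K[d_0] = A_0 *)
Definition cycle_ob (n : nat) : C :=
  if n is n'.+1 then ker_ob saC (moore_diff n') else A 0.

Definition cycle_incl (n : nat) : hom (cycle_ob n) (moore_ob n) :=
  match n as k return hom (cycle_ob k) (moore_ob k) with
  | 0 => idm (A 0)
  | n'.+1 => ker_mor saC (moore_diff n')
  end.

Lemma cycle_incl_mono n : mono (cycle_incl n).
Proof.
case: n => [|n]; first by move=> T a b; rewrite !comp1m.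
exact: ker_mono.
Qed.

Lemma boundary_ex n : exists d : hom (moore_ob n.+1) (cycle_ob n),
  cycle_incl n ∘ d = moore_diff n.
Proof.
case: n => [|n]; first by exists (moore_diff 0); apply: comp1m.
have [d [dE _]] := (ker_morP saC (moore_diff n)).2 _ _ (moore_diff_diff n).
by exists d.
Qed.

(* d'_(n+1) *)
Definition boundary n : hom (moore_ob n.+1) (cycle_ob n) :=
  sval (cid (boundary_ex n)).

Lemma boundaryP n : cycle_incl n ∘ boundary n = moore_diff n.
Proof. exact: svalP (cid (boundary_ex n)). Qed.

Definition homology n : C := coker_ob saC (boundary n).
Definition homology_proj n : hom (cycle_ob n) (homology n) :=
  coker_mor saC (boundary n).

End Complex.

Section Map.
Variables (A B : simplicial C) (f : simplicial_map A B).

Lemma moore_map_ex n : exists g : hom (moore_ob A n) (moore_ob B n),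
  moore_incl B n ∘ g = f n ∘ moore_incl A n.
Proof.
case: n => [|n]; first by exists (f 0); rewrite comp1m compm1.
apply: inter_ker_lift => i; rewrite compA -smap_face -compA.
exact: (zero_morphl _ (inter_ker_zero saC _ i)).
Qed.

Definition moore_map n : hom (moore_ob A n) (moore_ob B n) :=
  sval (cid (moore_map_ex n)).

Lemma moore_mapP n : moore_incl B n ∘ moore_map n = f n ∘ moore_incl A n.
Proof. exact: svalP (cid (moore_map_ex n)). Qed.

Lemma moore_map_diff n :
  moore_diff B n ∘ moore_map n.+1 = moore_map n ∘ moore_diff A n.
Proof.
apply: moore_incl_mono; rewrite !compA moore_diffP moore_mapP.
by rewrite -!compA moore_diffP moore_mapP !compA smap_face.
Qed.

Lemma cycle_map_ex n : exists g : hom (cycle_ob A n) (cycle_ob B n),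
  cycle_incl B n ∘ g = moore_map n ∘ cycle_incl A n.
Proof.
case: n => [|n].
  by exists (moore_map 0); rewrite [LHS]comp1m [RHS]compm1.
have [|g [gE _]] := (ker_morP saC (moore_diff B n)).2 _
  (moore_map n.+1 ∘ cycle_incl A n.+1); last by exists g.
rewrite compA moore_map_diff -compA; apply: zero_morphl.
exact: (ker_morP saC (moore_diff A n)).1.
Qed.

Definition cycle_map n : hom (cycle_ob A n) (cycle_ob B n) :=
  sval (cid (cycle_map_ex n)).

Lemma cycle_mapP n :
  cycle_incl B n ∘ cycle_map n = moore_map n ∘ cycle_incl A n.
Proof. exact: svalP (cid (cycle_map_ex n)). Qed.

Lemma homology_map_ex n : exists h : hom (homology A n) (homology B n),
  h ∘ homology_proj A n = homology_proj B n ∘ cycle_map n.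
Proof.
have [|h [hE _]] := (coker_morP saC (boundary A n)).2 _
  (homology_proj B n ∘ cycle_map n); last by exists h.
have E : cycle_map n ∘ boundary A n = boundary B n ∘ moore_map n.+1.
  apply: cycle_incl_mono; rewrite !compA cycle_mapP boundaryP -compA.
  by rewrite boundaryP moore_map_diff.
rewrite -compA E compA; apply: zero_morphr.
exact: (coker_morP saC (boundary B n)).1.
Qed.

Definition homology_map n : hom (homology A n) (homology B n) :=
  sval (cid (homology_map_ex n)).

Lemma homology_mapP n :
  homology_map n ∘ homology_proj A n = homology_proj B n ∘ cycle_map n.
Proof. exact: svalP (cid (homology_map_ex n)). Qed.

Definition homology_isomorphism : Prop :=
  forall n : nat, is_iso (homology_map n).

End Map.

End Homology.

(* Simplicial sets are simplicial objects in the category of types. *)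
Definition Types : category :=
  @Category Type (fun S T => S -> T) (fun S x => x)
    (fun S T U g f x => g (f x))
    (fun _ _ _ => erefl) (fun _ _ _ => erefl) (fun _ _ _ _ _ _ _ => erefl).

Definition simplicial_set := simplicial Types.

Definition simplex (K : simplicial_set) (n : nat) : Type := K n.
Definition sface (K : simplicial_set) n (i : 'I_n.+2) :
  simplex K n.+1 -> simplex K n := face K i.
Definition sdegen (K : simplicial_set) n (i : 'I_n.+1) :
  simplex K n -> simplex K n.+1 := degen K i.

Section HomotopyGroups.
Variables (K : simplicial_set) (x : simplex K 0).

Fixpoint basept (n : nat) : simplex K n :=
  if n is n'.+1 then sdegen ord0 (basept n') else x.

Definition is_sphere (n : nat) : simplex K n -> Prop :=
  match n as k return simplex K k -> Prop with
  | 0 => fun=> True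
  | n'.+1 => fun z => forall i : 'I_n'.+2, sface i z = basept n'
  end.

Definition sphere (n : nat) : Type := {z : simplex K n | is_sphere z}.

Definition homotopic n (z z' : sphere n) : Prop :=
  exists y : simplex K n.+1,
    [/\ forall i : 'I_n.+2, i < n -> sface i y = basept n,
        sface (inord n) y = sval z
      & sface ord_max y = sval z'].

(* The quotient of [sphere n] by [homotopic], as a set of classes; this is the
   n-th homotopy group when [homotopic] is an equivalence relation, which is
   the case for Kan complexes. *)
Definition homotopy_group (n : nat) : Type :=
  {c : sphere n -> Prop | exists z, c = homotopic z}.

Definition homotopy_class n (z : sphere n) : homotopy_group n :=
  exist _ (homotopic z) (ex_intro _ z erefl).

(* The graph of the product of the (n+1)-st homotopy group: [z] * [z'] is the
   class of z'' = d_(n+1) w, for w a filler of the horn with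
   faces d_n w = z, d_(n+2) w = z' and d_i w = x for i < n. *)
Definition homotopy_mul n (c c' c'' : homotopy_group n.+1) : Prop :=
  exists z z' z'' : sphere n.+1, exists w : simplex K n.+2,
    [/\ c = homotopy_class z, c' = homotopy_class z' & c'' = homotopy_class z'']
    /\ [/\ forall i : 'I_n.+3, i < n -> sface i w = basept n.+1,
           sface (inord n) w = sval z,
           sface (inord n.+1) w = sval z''
         & sface ord_max w = sval z'].

End HomotopyGroups.

Section InducedMap.
Variables (K L : simplicial_set) (f : simplicial_map K L).

Definition smapS n (z : simplex K n) : simplex L n := f n z.

Lemma smapS_face n (i : 'I_n.+2) (z : simplex K n.+1) :
  smapS (sface i z) = sface i (smapS z).
Proof. exact: (@congr1 (simplex K n.+1 -> simplex L n) _ (fun h => h z) _ _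
  (smap_face f i)). Qed.

Lemma smapS_basept (x : simplex K 0) n :
  smapS (basept x n) = basept (smapS x) n.
Proof.
elim: n => //= n <-.
exact: (@congr1 (simplex K n -> simplex L n.+1) _ (fun h => h (basept x n)) _ _
  (smap_degen f ord0)).
Qed.

Lemma smapS_sphere (x : simplex K 0) n (z : simplex K n) :
  is_sphere x z -> is_sphere (smapS x) (smapS z).
Proof.
by case: n z => //= n z zS i; rewrite -smapS_face zS smapS_basept.
Qed.

Definition sphere_map (x : simplex K 0) n (z : sphere x n) :
    sphere (smapS x) n :=
  exist _ (smapS (sval z)) (smapS_sphere (svalP z)).

(* The map sending the class of z to the class of f z is well defined and an
   isomorphism: a bijection, compatible with the products when n > 0. *)
Definition induces_iso (x : simplex K 0) (n : nat) : Prop :=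
  exists phi : homotopy_group x n -> homotopy_group (smapS x) n,
    [/\ forall z : sphere x n,
          phi (homotopy_class z) = homotopy_class (sphere_map z),
        bijective phi
      & match n as k
          return (homotopy_group x k -> homotopy_group (smapS x) k) -> Prop with
        | 0 => fun=> True
        | k.+1 => fun psi => forall a b c : homotopy_group x k.+1,
            homotopy_mul a b c -> homotopy_mul (psi a) (psi b) (psi c)
        end phi].

Definition sset_weak_equivalence : Prop :=
  forall (n : nat) (x : simplex K 0), induces_iso x n.

End InducedMap.

Section HomSimplicial.
Variables (C : category) (P : C).

Program Definition hom_simplicial (A : simplicial C) : simplicial_set :=
  @Simplicial Types (fun n => hom P (A n))
    (fun n i a => face A i ∘ a) (fun n i a => degen A i ∘ a) _ _ _ _ _ _.
Next Obligation. by apply: funext => a; rewrite !compA face_face. Qed.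
Next Obligation. by apply: funext => a; rewrite !compA degen_degen. Qed.
Next Obligation. by apply: funext => a; rewrite !compA face_degen_lt. Qed.
Next Obligation.
by apply: funext => a; rewrite /= compA face_degen_eq comp1m.
Qed.
Next Obligation.
by apply: funext => a; rewrite /= compA face_degen_eqS comp1m.
Qed.
Next Obligation. by apply: funext => a; rewrite !compA face_degen_gt. Qed.

Program Definition hom_simplicial_map (A B : simplicial C)
    (f : simplicial_map A B) :
    simplicial_map (hom_simplicial A) (hom_simplicial B) :=
  @SimplicialMap Types (hom_simplicial A) (hom_simplicial B)
    (fun n (a : hom P (A n)) => f n ∘ a) _ _.
Next Obligation. by apply: funext => a; rewrite /= !compA smap_face. Qed.
Next Obligation. by apply: funext => a; rewrite /= !compA smap_degen. Qed.

End HomSimplicial.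

Definition weak_equivalence (C : category) (A B : simplicial C)
    (f : simplicial_map A B) : Prop :=
  forall P : C, projective P -> sset_weak_equivalence (hom_simplicial_map P f).

(* Main.v *)
From mathcomp Require Import all_boot boolp.
Require Import Defs.

Set Implicit Arguments.
Unset Strict Implicit.
Unset Printing Implicit Defensive.

Local Open Scope cat_scope.

(** Let [P] be projective. Protomodularity, applied to the codiagonal
    [P + P -> P], leaves on the sets [Hom(P, X)] a trace of group structure,
    natural in [X]: there are a projective [Q], a subtraction
    [Hom(P, X) x Hom(P, X) -> Hom(Q, X)] with [sub a a = 0], and an addition
    [Hom(Q, X) x Hom(P, X) -> Hom(P, X)] with [add (sub a b) b = a]
    ([subtraction_ex]). Being natural, these operations are simplicial on
    [Hom(P, A)] for every simplicial object [A], and preserve spheres and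
    homotopies.

    They make all base points equivalent to zero. Subtracting [x] and adding it
    back makes [pi_n (Hom(P, A), x)] a retract of [pi_n (Hom(Q, A), 0)],
    naturally in [A]; as a retract of a bijection is a bijection, a simplicial
    map that is bijective on all homotopy groups at zero is so at every base
    point ([homot_bijective_retract]). They also give the Mal'tsev operation
    [add (sub a b) c], so that homotopy is an equivalence relation without any
    horn filling ([hom_homot_equivalence]), and compatibility with the products
    is automatic for a map that is simplicial ([induces_isoP]).

    At zero, [pi_n (Hom(P, A), 0)] is [Hom(P, H_n A)]. Indeed the spheres are
    the [P]-elements of the object of cycles, and homotopies are the edges of a
    reflexive graph on that object whose edges out of zero are the Moore chains
    of degree [n + 1]. In an exact protomodular category such a graph spans an
    effective equivalence relation, and its quotient is the cokernel of the
    boundary, that is, [H_n A]; projectivity of [P] lifts pairs in the relation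
    to actual edges ([cokernel_reflexive_graph], [homology_proj_eq]).

    As there are enough projectives, [H_n f] is an isomorphism exactly when it
    induces a bijection on [P]-elements for every projective [P]
    ([homology_map_isoP]), and the two notions agree. *)

(** * Projective objects, regular epimorphisms and cokernels *)

Section Epimorphisms.
Variables (C : category) (saC : semi_abelian C).
Implicit Types P Q X Y Z T : C.

Lemma mono_zero_morph T X Y (m : hom X Y) (g : hom T X) :
  mono m -> zero_morph (m ∘ g) -> zero_morph g.
Proof.
move=> mm zmg; have [z zz] := zero_morph_ex saC T X.
rewrite (mm _ g z) //.
by apply: (zero_morph_eq saC) => //; exact: zero_morphl.
Qed.

Lemma regular_epi_mono_fill X Y M T (e : hom X Y) (m : hom M T)
    (a : hom X M) (b : hom Y T) :
  regular_epi e -> mono m -> m ∘ a = b ∘ e ->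
  exists d : hom Y M, d ∘ e = a /\ m ∘ d = b.
Proof.
move=> re mm mabe; have [W [f [g fge]]] := re.
have [|d [de _]] := fge.2 M a.
  by apply: mm; rewrite !compA mabe -!compA fge.1.
exists d; split=> //; apply: (regular_epi_epi re).
by rewrite -compA de.
Qed.

Lemma mono_regular_epi_factor_iso X Y W (h : hom X Y) (t : hom W X) :
  mono h -> regular_epi (h ∘ t) -> is_iso h.
Proof.
move=> mh re.
have [|r [_ hr]] := regular_epi_mono_fill (a := t) (b := idm Y) re mh.
  by rewrite comp1m.
by exists r; split=> //; apply: mh; rewrite compA hr comp1m compm1.
Qed.

Lemma cokernel_regular_epi X Y Q (f : hom X Y) (q : hom Y Q) :
  is_cokernel f q -> regular_epi q.
Proof.
move=> [zqf qU]; have [z zz] := zero_morph_ex saC X Y.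
exists X, f, z; split.
  by apply: (zero_morph_eq saC) => //; exact: zero_morphl.
by move=> T h hfz; apply: qU; rewrite hfz; exact: zero_morphl.
Qed.

End Epimorphisms.

(** * Subtraction on projective generalised elements *)

Section Subtraction.
Variables (C : category).
Implicit Types P Q X Y : C.

Definition natural2 P P' Q
    (op : forall X, hom P X -> hom P' X -> hom Q X) : Prop :=
  forall X Y (g : hom X Y) a b, g ∘ op X a b = op Y (g ∘ a) (g ∘ b).

(** The trace left by protomodularity on the sets Hom(P, X): in a group, with
    [Q := P], these are [x - y] and [w + y].  In general the difference of two
    [P]-elements is only an element of another shape [Q]. *)
Record subtraction P Q := Subtraction {
  sub : forall X, hom P X -> hom P X -> hom Q X;
  add : forall X, hom Q X -> hom P X -> hom P X;
  sub_natural : natural2 sub;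
  add_natural : natural2 add;
  sub_self : forall X (a : hom P X), zero_morph (sub a a);
  add_sub : forall X (a b : hom P X), add (sub a b) b = a }.

Variable saC : semi_abelian C.

Lemma add_zero P Q (S : subtraction P Q) X (w : hom Q X) (a : hom P X) :
  zero_morph w -> add S w a = a.
Proof.
move=> zw; rewrite -[RHS](add_sub S a a).
by rewrite (zero_morph_eq saC zw (sub_self S a)).
Qed.

(** A point is strongly generated by its kernel and its section: the Short
    Five Lemma makes any subobject containing both of them the whole object. *)
Lemma mono_kernel_section_iso K X Y M (p : hom X Y) (s : hom Y X)
    (k : hom K X) (m : hom M X) (k' : hom K M) (s' : hom Y M) :
  p ∘ s = idm Y -> is_kernel p k -> mono m -> m ∘ k' = k -> m ∘ s' = s ->
  is_iso m.
Proof.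
move=> ps kerk mm mk ms.
have id_iso Z : is_iso (idm Z) by exists (idm Z); rewrite comp1m.
apply: (sa_protomodular saC (k := k') (k' := k) (p := p ∘ m) (p' := p)
          (u := idm K) (w := idm Y)) => //.
- by apply: (@split_epi_regular _ _ _ _ s'); rewrite -compA ms.
- exact: split_epi_regular ps.
- split; first by rewrite -compA mk; exact: kerk.1.
  move=> T g; rewrite -compA => zg; have [h [kh hU]] := kerk.2 T _ zg.
  exists h; split; first by apply: mm; rewrite compA mk.
  by move=> h' k'h'; apply: hU; rewrite -mk -compA k'h'.
- by rewrite mk compm1.
- by rewrite comp1m.
Qed.

(** The universal instance lives in [P + P]: the difference of the two
    injections is a projective cover [Q] of the kernel of the codiagonal, which
    together with the second injection covers [P + P]; lifting the first
    injection along that cover gives the formula for addition. *)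
Lemma subtraction_ex (epC : enough_projectives C) P :
  projective P -> exists Q, projective Q /\ inhabited (subtraction P Q).
Proof.
move=> pP; have [S [i1 [i2 copS]]] := sa_coproducts saC P P.
have [codiag [[cd1 cd2] _]] := copS P (idm P) (idm P).
have [K [k kerk]] := kernel_ex saC codiag.
have [Q [e [pQ re]]] := epC K.
have [R [j1 [j2 copR]]] := sa_coproducts saC Q P.
have [t [[t1 t2] _]] := copR S (k ∘ e) i2.
have [M [q [m [rq mm tE]]]] := image_ex saC t.
have [|k' [_ mk']] := regular_epi_mono_fill (a := q ∘ j1) (b := k) re mm.
  by rewrite compA -tE.
have [|mi [_ mmi]] := mono_kernel_section_iso (s' := q ∘ j2) cd2 kerk mm mk'.
  by rewrite compA -tE.
have [theta qtheta] := pP _ _ q rq (mi ∘ i1).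
have ttheta : t ∘ theta = i1 by rewrite tE -compA qtheta compA mmi comp1m.
have copair_ex A B D (a : hom A D) (b : hom B D) X (x : hom A X) (y : hom B X) :
    is_coproduct a b -> exists h : hom D X, h ∘ a = x /\ h ∘ b = y.
  by move=> /(_ X x y)[h [? _]]; exists h.
have copair_eq A B D (a : hom A D) (b : hom B D) X (h h' : hom D X) :
    is_coproduct a b -> h ∘ a = h' ∘ a -> h ∘ b = h' ∘ b -> h = h'.
  by move=> /(_ X (h ∘ a) (h ∘ b))[l [_ lU]] ha hb; rewrite -(lU h) // -(lU h').
pose cS X (x y : hom P X) := sval (cid (copair_ex _ _ _ _ _ X x y copS)).
have cSP X (x y : hom P X) : cS X x y ∘ i1 = x /\ cS X x y ∘ i2 = y.
  by rewrite /cS; case: cid.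
pose cR X (x : hom Q X) (y : hom P X) :=
  sval (cid (copair_ex _ _ _ _ _ X x y copR)).
have cRP X (x : hom Q X) (y : hom P X) :
    cR X x y ∘ j1 = x /\ cR X x y ∘ j2 = y.
  by rewrite /cR; case: cid.
exists Q; split=> //; constructor.
apply: (@Subtraction P Q (fun X x y => cS X x y ∘ (k ∘ e))
                         (fun X x y => cR X x y ∘ theta)).
- move=> X Y g a b /=; rewrite (compA g); congr (comp _ _).
  have [c1 c2] := cSP X a b; have [d1 d2] := cSP Y (g ∘ a) (g ∘ b).
  by apply: (copair_eq _ _ _ _ _ _ _ _ copS); rewrite -compA ?c1 ?c2 ?d1 ?d2.
- move=> X Y g a b /=; rewrite (compA g); congr (comp _ _).
  have [c1 c2] := cRP X a b; have [d1 d2] := cRP Y (g ∘ a) (g ∘ b).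
  by apply: (copair_eq _ _ _ _ _ _ _ _ copR); rewrite -compA ?c1 ?c2 ?d1 ?d2.
- move=> X a; have [c1 c2] := cSP X a a.
  have -> : cS X a a = a ∘ codiag.
    by apply: (copair_eq _ _ _ _ _ _ _ _ copS); rewrite -compA ?cd1 ?cd2 compm1.
  rewrite compA -(compA a); apply: zero_morphr; apply: zero_morphl.
  exact: kerk.1.
- move=> X a b /=; have [c1 c2] := cSP X a b.
  have [d1 d2] := cRP X (cS X a b ∘ (k ∘ e)) b.
  rewrite -[RHS]c1 -ttheta [RHS]compA; congr (comp _ _).
  by apply: (copair_eq _ _ _ _ _ _ _ _ copR); rewrite -compA ?t1 ?t2 ?c2.
Qed.

End Subtraction.

(** * Reflexive graphs *)

Section ReflexiveGraph.
Variables (C : category) (saC : semi_abelian C).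

(** Protomodularity makes a reflexive relation Euclidean, hence symmetric and
    transitive, and exactness then makes it a kernel pair. *)
Lemma reflexive_relation_effective (X R : C) (r1 r2 : hom R X) (s : hom X R) :
  (forall T (a b : hom T R), r1 ∘ a = r1 ∘ b -> r2 ∘ a = r2 ∘ b -> a = b) ->
  r1 ∘ s = idm X -> r2 ∘ s = idm X ->
  exists Y (f : hom X Y), is_kernel_pair f r1 r2.
Proof.
move=> rmono r1s r2s.
have [P [p [q prod]]] := product_ex saC X X.
have [m [[pm qm] _]] := prod R r1 r2.
have mm : mono m.
  by move=> T a b mab; apply: rmono; rewrite -?pm -?qm -!compA mab.
have euclid T (a b : hom T R) : r1 ∘ a = r1 ∘ b ->
    exists c : hom T R, r1 ∘ c = r2 ∘ a /\ r2 ∘ c = r2 ∘ b.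
  move=> ab; have := @reflexive_euclidean C saC X P R p q m s prod mm.
  by rewrite pm qm; apply.
(* The pairs (a, b) and (a, a) are both in the relation, hence so is (b, a). *)
have [|r [r1r r2r]] := euclid R (idm R) (s ∘ r1).
  by rewrite compm1 compA r1s comp1m.
rewrite compm1 in r1r; rewrite compA r2s comp1m in r2r.
apply: (sa_exact saC).2; split=> //; [by exists s | by exists r |].
move=> T p1 p2 [p12 _]; have [|c [c1 c2]] := euclid T (r ∘ p1) p2.
  by rewrite compA r1r.
by exists c; rewrite c1 compA r2r.
Qed.

(** Seen from a projective object, the cokernel of the kernel of one leg
    followed by the other leg is the quotient by the relation that the graph
    spans.  That relation is reflexive, hence the kernel pair of some map, which
    then factors through the cokernel; conversely, every edge differs from a
    degenerate one by an element of the kernel. *)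
Lemma cokernel_reflexive_graph (epC : enough_projectives C) (E Z N Q P : C)
    (u v : hom E Z) (s : hom Z E) (k : hom N E) (c : hom Z Q) (z z' : hom P Z) :
  u ∘ s = idm Z -> v ∘ s = idm Z -> is_kernel u k -> is_cokernel (v ∘ k) c ->
  projective P ->
  c ∘ z = c ∘ z' <-> exists w : hom P E, u ∘ w = z /\ v ∘ w = z'.
Proof.
move=> us vs keru cokc pP; split; last first.
  move=> [w [<- <-]].
  have [P' [_ [S]]] := subtraction_ex saC epC pP.
  have [|h [kh _]] := keru.2 P' (sub S w (s ∘ (u ∘ w))).
    rewrite sub_natural compA us comp1m; exact: sub_self.
  have wE := add_sub S w (s ∘ (u ∘ w)).
  rewrite -[in RHS]wE !add_natural -kh (add_zero saC).
    by rewrite !compA -(compA c v s) vs compm1.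
  by rewrite !compA -(compA c); apply: zero_morphr; exact: cokc.1.
move=> czz'.
have [D [p [q prod]]] := product_ex saC Z Z.
have [uv [[puv quv] _]] := prod E u v.
have [R [e [m [re mm uvE]]]] := image_ex saC uv.
have ue : u = p ∘ m ∘ e by rewrite -compA -uvE.
have ve : v = q ∘ m ∘ e by rewrite -compA -uvE.
have [|||Y [f kp]] :=
    @reflexive_relation_effective Z R (p ∘ m) (q ∘ m) (e ∘ s).
- move=> T a b pab qab; apply: mm.
  have [d [_ dU]] := prod T (p ∘ m ∘ a) (q ∘ m ∘ a).
  by rewrite -(dU (m ∘ a)) ?compA //; apply: dU; rewrite !compA -pab -qab.
- by rewrite compA -ue.
- by rewrite compA -ve.
have fuv : f ∘ u = f ∘ v by rewrite ue ve compA kp.1 -!compA.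
have [|h [fE _]] := cokc.2 Y f.
  rewrite compA -fuv -compA; apply: zero_morphl; exact: keru.1.
have [|r [[r1 r2] _]] := kp.2 P z z'; first by rewrite -fE -!compA czz'.
have [w ew] := pP _ _ e re r.
by exists w; rewrite ue ve -!compA ew !compA.
Qed.

End ReflexiveGraph.

(** * Spheres and homotopies in simplicial sets *)

Section SimplicialSets.
Variable K : simplicial_set.

Lemma sdegen_basept (x : simplex K 0) n (j : 'I_n.+1) :
  sdegen j (basept x n) = basept x n.+1.
Proof.
elim: n j => [|n IHn] j; first by rewrite (ord1 j).
have [->//|[j' ->]] : j = ord0 \/ exists j', j = next j'.
  by case: (unliftP ord0 j) => [j' ->|->]; [right; exists j' | left].
have := congr1 (fun h => h (basept x n)) (degen_degen K (leq0n j' : ord0 <= j')).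
have -> : keep ord0 = ord0 :> 'I_n.+2 by apply: val_inj.
move=> E; apply: (etrans E); exact: (congr1 (sdegen ord0) (IHn j')).
Qed.

Lemma sface_basept (x : simplex K 0) n (i : 'I_n.+2) :
  sface i (basept x n.+1) = basept x n.
Proof.
have face0 m (y : simplex K m) : sface ord0 (sdegen ord0 y) = y.
  have -> : ord0 = keep ord0 :> 'I_m.+2 by apply: val_inj.
  exact: (congr1 (fun h => h y) (face_degen_eq K ord0)).
have face1 m (y : simplex K m) : sface (next ord0) (sdegen ord0 y) = y.
  exact: (congr1 (fun h => h y) (face_degen_eqS K ord0)).
elim: n i => [|n IHn] i; case: (unliftP ord0 i) => [i'|] -> //=.
  by rewrite (ord1 i'); exact: face1.
have [->|i'0] := eqVneq i' ord0; first exact: face1.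
have i'gt0 : (ord0 : 'I_n.+1) < i' by rewrite lt0n.
have := congr1 (fun h => h (basept x n.+1)) (face_degen_gt K i'gt0).
have -> : keep ord0 = ord0 :> 'I_n.+2 by apply: val_inj.
move=> E; apply: (etrans E).
exact: (congr1 (sdegen ord0) (IHn i')).
Qed.

Variable x : simplex K 0.

Lemma is_sphere_basept n : is_sphere x (basept x n).
Proof. by case: n => //= n i; exact: sface_basept. Qed.

(** [homotopic] without the packaging of its arguments as spheres, so that it
    can be transported along equations between simplices. *)
Definition homot n (z z' : simplex K n) : Prop :=
  exists y : simplex K n.+1,
    [/\ forall i : 'I_n.+2, i < n -> sface i y = basept x n,
        sface (inord n) y = z
      & sface ord_max y = z'].

Lemma inord_keep n : inord n = keep ord_max :> 'I_n.+2.
Proof. by apply: val_inj; rewrite /= inordK. Qed.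

Lemma ord_max_next n : ord_max = next ord_max :> 'I_n.+2.
Proof. exact: val_inj. Qed.

Lemma sdegen_sphere n (z : simplex K n) : is_sphere x z ->
  [/\ forall i : 'I_n.+2, i < n -> sface i (sdegen ord_max z) = basept x n,
      sface (inord n) (sdegen ord_max z) = z
    & sface ord_max (sdegen ord_max z) = z].
Proof.
move=> sz; split.
- case: n z sz => // n z sz i i_lt.
  have i_lt' : i < n.+2 by exact: leq_trans i_lt _.
  have -> : i = keep (Ordinal i_lt') by apply: val_inj.
  rewrite [X in sdegen X _]ord_max_next.
  have le : (Ordinal i_lt' : 'I_n.+2) <= (ord_max : 'I_n.+1) by [].
  apply: (etrans (congr1 (fun h => h z) (face_degen_lt K le))).
  apply: (etrans (congr1 (sdegen ord_max) (sz _))).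
  exact: sdegen_basept.
- rewrite inord_keep.
  exact: (congr1 (fun h => h z) (face_degen_eq K ord_max)).
- rewrite [X in sface X _]ord_max_next.
  exact: (congr1 (fun h => h z) (face_degen_eqS K ord_max)).
Qed.

Lemma homot_refl n (z : simplex K n) : is_sphere x z -> homot z z.
Proof. by move=> /sdegen_sphere; exists (sdegen ord_max z). Qed.

End SimplicialSets.

(** * Isomorphisms on homotopy groups, on representatives *)

Section HomotopyGroupIso.

Definition homot_equivalence K (x : simplex K 0) n : Prop :=
  [/\ forall z z' : simplex K n, is_sphere x z -> is_sphere x z' ->
        homot x z z' -> homot x z' z
    & forall z1 z2 z3 : simplex K n, is_sphere x z2 ->
        homot x z1 z2 -> homot x z2 z3 -> homot x z1 z3].

Definition homot_bijective K L (f : simplicial_map K L) (x : simplex K 0) n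
    : Prop :=
  [/\ forall z z' : simplex K n, is_sphere x z -> is_sphere x z' ->
        homot (smapS f x) (smapS f z) (smapS f z') -> homot x z z'
    & forall w : simplex L n, is_sphere (smapS f x) w ->
        exists2 z : simplex K n, is_sphere x z & homot (smapS f x) (smapS f z) w].

Lemma homotopy_class_eq K (x : simplex K 0) n (z z' : sphere x n) :
  homot_equivalence x n ->
  homotopy_class z = homotopy_class z' <-> homot x (sval z) (sval z').
Proof.
move=> [sym trans]; split=> [[E]|zz'].
  have : homotopic z' z' by exact: homot_refl (svalP z').
  by rewrite -E.
apply: eq_exist; apply: funext => w; apply: propext; split=> zw.
  by apply: trans zw; [exact: svalP | apply: sym => //; exact: svalP].
by apply: trans zw => //; exact: svalP.
Qed.

Lemma smapS_homot K L (f : simplicial_map K L) (x : simplex K 0) n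
    (z z' : simplex K n) :
  homot x z z' -> homot (smapS f x) (smapS f z) (smapS f z').
Proof.
move=> [y [yb yn ymax]]; exists (smapS f y); split=> [i i_n||].
- by rewrite -smapS_face yb // smapS_basept.
- by rewrite -smapS_face yn.
- by rewrite -smapS_face ymax.
Qed.

(** The products are defined by fillers, which a simplicial map carries to
    fillers, so that bijectivity is the whole content of [induces_iso]. *)
Lemma induces_isoP K L (f : simplicial_map K L) (x : simplex K 0) n :
  homot_equivalence x n -> homot_equivalence (smapS f x) n ->
  induces_iso f x n <-> homot_bijective f x n.
Proof.
move=> eqK eqL; split.
  move=> [phi [phiE [psi phiK psiK] _]]; split.
    move=> z z' sz sz' fzz'.
    apply/(homotopy_class_eq (exist _ z sz) (exist _ z' sz') eqK).
    by apply: (can_inj phiK); rewrite !phiE; apply/(homotopy_class_eq _ _ eqL).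
  move=> w sw.
  have [_ [z ->] psiE] : exists2 c, (exists z : sphere x n, c = homotopy_class z)
      & phi c = homotopy_class (exist _ w sw).
    exists (psi (homotopy_class (exist _ w sw))); last exact: psiK.
    by case: (psi _) => c [z cE]; exists z; apply: eq_exist.
  exists (sval z); first exact: svalP.
  apply/(homotopy_class_eq (sphere_map f z) (exist _ w sw) eqL).
  by rewrite -phiE.
move=> [f_inj f_surj].
pose rep (c : homotopy_group x n) : sphere x n := sval (cid (svalP c)).
have repK c : homotopy_class (rep c) = c.
  by rewrite /rep; case: cid => z /=; case: c => c cP /= cE; apply: eq_exist.
pose phi c := homotopy_class (sphere_map f (rep c)).
have phiE z : phi (homotopy_class z) = homotopy_class (sphere_map f z).
  apply/(homotopy_class_eq _ _ eqL); apply: smapS_homot.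
  by apply/(homotopy_class_eq _ _ eqK); rewrite repK.
exists phi; split=> //.
- have phi_surj d : exists c, phi c = d.
    case: d => d [w dE].
    have [z sz fzw] := f_surj _ (svalP w).
    exists (homotopy_class (exist _ z sz)); rewrite phiE.
    transitivity (homotopy_class w); last exact: eq_exist.
    exact/(homotopy_class_eq _ _ eqL).
  have phi_inj : injective phi.
    move=> c c'; rewrite -(repK c) -(repK c') !phiE.
    move=> /(homotopy_class_eq _ _ eqL) /f_inj cc'; apply/(homotopy_class_eq _ _ eqK).
    by apply: cc'; exact: svalP.
  exists (fun d => sval (cid (phi_surj d))) => [c|d].
    by case: cid => c' /= /phi_inj.
  by case: cid.
- case: n eqK eqL f_inj f_surj rep repK phi phiE => // n _ _ _ _ rep _ phi phiE.
  move=> _ _ _ [z [z' [z'' [w [[-> -> ->] [wb wn wn1 wmax]]]]]].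
  exists (sphere_map f z), (sphere_map f z'), (sphere_map f z''), (smapS f w).
  rewrite !phiE; split=> //; split=> [i i_n|||].
  + by rewrite -smapS_face wb // smapS_basept.
  + by rewrite -smapS_face wn.
  + by rewrite -smapS_face wn1.
  + by rewrite -smapS_face wmax.
Qed.

End HomotopyGroupIso.

(** * Natural operations on the simplicial sets Hom(P, A) *)

Section HomOperations.
Variables (C : category) (saC : semi_abelian C) (A : simplicial C).
Local Notation HomA P := (hom_simplicial P A).

(** A natural operation is a simplicial map from [Hom(P, A) x Hom(P', A)] to
    [Hom(Q, A)], so it carries pairs of spheres, or of homotopies, to spheres
    and homotopies at the combined base point. *)
Section Binary.
Variables (P P' Q : C) (op : forall X, hom P X -> hom P' X -> hom Q X).
Hypothesis opN : natural2 op.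
Variables (x : simplex (HomA P) 0) (x' : simplex (HomA P') 0).

Definition op_simplex n (a : simplex (HomA P) n) (b : simplex (HomA P') n) :
  simplex (HomA Q) n := op a b.

Lemma op_basept n :
  op_simplex (basept x n) (basept x' n) = basept (op_simplex x x') n.
Proof. by elim: n => //= n <-; rewrite /op_simplex -opN. Qed.

Lemma op_face n (i : 'I_n.+2) a b :
  sface i (op_simplex a b) = op_simplex (sface i a) (sface i b).
Proof. exact: opN. Qed.

Lemma op_sphere n (a : simplex (HomA P) n) (b : simplex (HomA P') n) :
  is_sphere x a -> is_sphere x' b ->
  is_sphere (op_simplex x x') (op_simplex a b).
Proof.
case: n a b => // n a b sa sb i.
by rewrite op_face (sa i) (sb i) op_basept.
Qed.

Lemma op_homot n (a b : simplex (HomA P) n) (a' b' : simplex (HomA P') n) :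
  homot x a b -> homot x' a' b' ->
  homot (op_simplex x x') (op_simplex a a') (op_simplex b b').
Proof.
move=> [y [yb yn ym]] [y' [yb' yn' ym']]; exists (op_simplex y y').
split=> [i i_n||]; rewrite op_face.
- by rewrite yb // yb' // op_basept.
- by rewrite yn yn'.
- by rewrite ym ym'.
Qed.

End Binary.

(** The natural operation [m a b c := add (sub a b) c] is a Mal'tsev operation,
    [m a b b = a] and [m a a c = c], and preserves the reflexive relation of
    homotopy. Applied to [z ~ z], [z ~ z'], [z' ~ z'] it gives symmetry, and
    applied to [z1 ~ z2], [z2 ~ z2], [z2 ~ z3] it gives transitivity. *)
Lemma hom_homot_equivalence P Q (S : subtraction P Q) (x : simplex (HomA P) 0)
    n : homot_equivalence x n.
Proof.
have maltsev (a1 b1 a2 b2 a3 b3 : simplex (HomA P) n) :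
    homot x a1 b1 -> homot x a2 b2 -> homot x a3 b3 ->
    homot x (add S (sub S a1 a2) a3 : simplex (HomA P) n)
            (add S (sub S b1 b2) b3 : simplex (HomA P) n).
  move=> h1 h2 h3.
  have := op_homot (add_natural S) (op_homot (sub_natural S) h1 h2) h3.
  by rewrite /op_simplex add_sub.
split=> [z z' sz sz' zz'|z1 z2 z3 s2 z12 z23].
  have := maltsev _ _ _ _ _ _ (homot_refl sz) zz' (homot_refl sz').
  by rewrite add_sub (add_zero saC) //; exact: sub_self.
have := maltsev _ _ _ _ _ _ z12 (homot_refl s2) z23.
by rewrite add_sub (add_zero saC) //; exact: sub_self.
Qed.

End HomOperations.

(** * Change of base point *)

Section ChangeOfBasePoint.
Variables (C : category) (saC : semi_abelian C) (A B : simplicial C).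
Variable f : simplicial_map A B.
Local Notation homf P := (hom_simplicial_map P f).

(** Subtracting [x] and adding it back exhibits the homotopy classes of
    [P]-spheres at [x] as a retract, naturally in [A], of those of [Q]-spheres
    at zero, and a retract of a bijection is a bijection. *)
Lemma homot_bijective_retract P Q (S : subtraction P Q)
    (x : simplex (hom_simplicial P A) 0) n :
  homot_bijective (homf Q) (op_simplex (@sub _ _ _ S) x x) n ->
  homot_bijective (homf P) x n.
Proof.
move=> [f_inj f_surj].
set x0 := op_simplex _ x x in f_inj f_surj.
have zx0 : zero_morph x0 by exact: sub_self.
have fx0 : smapS (homf Q) x0 =
    op_simplex (@sub _ _ _ S) (smapS (homf P) x) (smapS (homf P) x).
  exact: sub_natural.
pose b := basept x n; pose b' := basept (smapS (homf P) x) n.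
have fb : smapS (homf P) b = b' by exact: smapS_basept.
have addx0 : op_simplex (@add _ _ _ S) x0 x = x by exact: add_zero.
have addfx0 : op_simplex (@add _ _ _ S) (smapS (homf Q) x0) (smapS (homf P) x)
    = smapS (homf P) x.
  by apply: (add_zero saC); exact: zero_morphl.
split.
- move=> z z' sz sz' fzz'.
  have sb : is_sphere x b by exact: is_sphere_basept.
  have sb' : is_sphere (smapS (homf P) x) b' by exact: is_sphere_basept.
  have := op_homot (sub_natural S) fzz' (homot_refl sb').
  rewrite -fx0 -fb /op_simplex -!sub_natural => /f_inj zz'.
  have /zz' zz'0 := op_sphere (sub_natural S) sz sb.
  have /zz'0 zz'1 := op_sphere (sub_natural S) sz' sb.
  have := op_homot (add_natural S) zz'1 (homot_refl sb).
  by rewrite addx0 /op_simplex !add_sub.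
- move=> w sw.
  have sb : is_sphere x b by exact: is_sphere_basept.
  have sb' : is_sphere (smapS (homf P) x) b' by exact: is_sphere_basept.
  have := op_sphere (sub_natural S) sw sb'.
  rewrite -fx0 => /f_surj[v sv fvw].
  exists (op_simplex (@add _ _ _ S) v b).
    by have := op_sphere (add_natural S) sv sb; rewrite addx0.
  have := op_homot (add_natural S) fvw (homot_refl sb').
  rewrite addfx0 -fb /op_simplex -add_natural.
  by rewrite fb add_sub.
Qed.

End ChangeOfBasePoint.

(** * Homotopies at the zero base point and homology *)

Section HomologyElements.
Variables (C : category) (saC : semi_abelian C).
Local Notation Cyc := (cycle_ob saC).

Section OneObject.
Variable A : simplicial C.

Definition cycle_simplex n : hom (Cyc A n) (A n) :=
  moore_incl saC A n ∘ cycle_incl saC A n.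

Lemma cycle_simplex_mono n : mono (cycle_simplex n).
Proof.
move=> T a b; rewrite -!compA => ab.
by apply: (cycle_incl_mono (saC := saC)); apply: moore_incl_mono ab.
Qed.

Lemma basept_zero T (x : hom T (A 0)) n : zero_morph x ->
  zero_morph (basept (x : simplex (hom_simplicial T A) 0) n : hom T (A n)).
Proof. by move=> zx; elim: n => //= n; exact: zero_morphl. Qed.

Lemma sphere_face_zero T (x : hom T (A 0)) n (t : hom T (A n.+1)) :
  zero_morph x ->
  is_sphere (x : simplex (hom_simplicial T A) 0)
            (t : simplex (hom_simplicial T A) n.+1) <->
  forall i : 'I_n.+2, zero_morph (face A i ∘ t).
Proof.
move=> zx; split=> st i.
  have -> : face A i ∘ t = basept (x : simplex (hom_simplicial T A) 0) n.
    exact: (st i).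
  exact: basept_zero.
by apply: (zero_morph_eq saC); [exact: st | exact: basept_zero].
Qed.

(** A Moore chain is a cycle when its last face vanishes as well, so the object
    of cycles is the intersection of the kernels of all the faces. *)
Lemma sphere_zero T (x : hom T (A 0)) n (t : hom T (A n)) : zero_morph x ->
  is_sphere (x : simplex (hom_simplicial T A) 0)
            (t : simplex (hom_simplicial T A) n) <->
  exists h, cycle_simplex n ∘ h = t.
Proof.
move=> zx; case: n t => [|n] t.
  by split=> // _; exists t; rewrite /cycle_simplex /= !comp1m.
rewrite (sphere_face_zero _ zx); split=> [zt|[h <-] i].
  have [i|g gE] := inter_ker_lift saC
    (f := fun i : 'I_n.+1 => face A (keep i)) (g := t); first exact: zt.
  have [|h [hE _]] := (ker_morP saC (moore_diff saC A n)).2 T g.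
    apply: (mono_zero_morph saC (@moore_incl_mono _ saC A n)).
    by rewrite compA moore_diffP -compA [_ ∘ g]gE; exact: zt.
  by exists h; rewrite /cycle_simplex -compA [_ ∘ h]hE.
rewrite /cycle_simplex -!compA compA.
case: (unliftP ord_max i) => [i'|] ->.
  have -> : lift ord_max i' = keep i' by apply: val_inj; exact: lift_max.
  by apply: zero_morphr; exact: inter_ker_zero.
rewrite -moore_diffP -compA (compA (moore_diff saC A n)); apply: zero_morphl.
by apply: zero_morphr; exact: (ker_morP saC _).1.
Qed.

Lemma sphere_cycle T (x : hom T (A 0)) n (h : hom T (Cyc A n)) : zero_morph x ->
  is_sphere (x : simplex (hom_simplicial T A) 0)
            (cycle_simplex n ∘ h : simplex (hom_simplicial T A) n).
Proof. by move=> zx; apply/(sphere_zero _ zx); exists h. Qed.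

(** Homotopies at the zero base point. Only the first of the two last faces is
    required to be a cycle, since the simplicial identities then make the other
    one a cycle too; this lets a pullback represent them. *)
Lemma homotopy_object_ex n : exists E (e : hom E (A n.+1)), mono e /\
  forall T (y : hom T (A n.+1)), (exists h, e ∘ h = y) <->
    (forall i : 'I_n.+2, i < n -> zero_morph (face A i ∘ y)) /\
    exists z, cycle_simplex n ∘ z = face A (inord n) ∘ y.
Proof.
pose F (i : 'I_n) : hom (A n.+1) (A n) := face A (keep (keep i)).
pose l := inter_ker_mor saC F.
have lmono : mono l.
  move=> T a b lab; have [|h [_ hU]] := (inter_ker_morP saC F).2 T (l ∘ a).
    move=> i; have [g gE] := (inter_ker_morP saC F).1 i.
    by exists (g ∘ a); rewrite compA gE.
  by rewrite -(hU a) // -(hU b).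
have [E [p [u pb]]] := pullback_ex saC (face A (inord n) ∘ l) (cycle_simplex n).
exists E, (l ∘ p); split.
  move=> T a b; rewrite -!compA => /lmono pab.
  apply: (pullback_mono_eq pb) => //.
  by apply: (@cycle_simplex_mono n); rewrite !compA -pb.1 -!compA pab.
move=> T y; split=> [[h <-]|[y_zero [z zE]]].
  split; last by exists (u ∘ h); rewrite !compA -pb.1.
  move=> i i_n; have -> : i = keep (keep (Ordinal i_n)) by apply: val_inj.
  rewrite !compA; do 2![apply: zero_morphr].
  exact: (inter_ker_zero saC F).
have [i|g gE] := inter_ker_lift saC (f := F) (g := y).
  by apply: y_zero => /=.
have [|h [[ph _] _]] := pb.2 T g z; first by rewrite -compA [_ ∘ g]gE zE.
by exists h; rewrite -compA ph.
Qed.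

(** The graph of homotopies at the zero base point, with the two last faces as
    legs and the last degeneracy as section. The leg [u] vanishes on an edge
    when all its faces but the last do, so its kernel is the next Moore object,
    on which the other leg is the boundary. *)
Lemma homotopy_graph_ex n : exists E (e : hom E (A n.+1))
    (u v : hom E (Cyc A n)) (s : hom (Cyc A n) E)
    (k : hom (moore_ob saC A n.+1) E),
  [/\ forall T (y : hom T (A n.+1)), (exists h, e ∘ h = y) <->
        (forall i : 'I_n.+2, i < n -> zero_morph (face A i ∘ y)) /\
        exists z, cycle_simplex n ∘ z = face A (inord n) ∘ y,
      cycle_simplex n ∘ u = face A (inord n) ∘ e,
      cycle_simplex n ∘ v = face A ord_max ∘ e
    & [/\ u ∘ s = idm _, v ∘ s = idm _, is_kernel u k
        & v ∘ k = boundary saC A n]].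
Proof.
have [E [e [emono eP]]] := homotopy_object_ex n; exists E, e.
have [e_zero [u uE]] := (eP E e).1 (ex_intro _ (idm E) (compm1 e)).
have [x zx] := zero_morph_ex saC E (A 0).
have [v vE] : exists v, cycle_simplex n ∘ v = face A ord_max ∘ e.
  apply/(sphere_zero _ zx); clear emono eP.
  case: n e u e_zero uE => // m e u e_zero uE i.
  apply: (zero_morph_eq saC); last exact: basept_zero.
  change (zero_morph (face A i ∘ (face A ord_max ∘ e))).
  rewrite compA ord_max_next face_face ?leq_ord // -compA.
  have [i_m|m_i] := ltnP i m.+1; first exact/zero_morphl/e_zero.
  have -> : keep i = inord m.+1.
    apply: val_inj; rewrite /= inordK //.
    by apply/eqP; rewrite eqn_leq m_i leq_ord.
  have [y zy] := zero_morph_ex saC E (A 0).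
  by rewrite -uE; exact: (sphere_face_zero _ zy).1 (sphere_cycle u zy) _.
have [s sE] : exists s, e ∘ s = degen A ord_max ∘ cycle_simplex n.
  have [y zy] := zero_morph_ex saC (Cyc A n) (A 0).
  have := sphere_cycle (idm (Cyc A n)) zy.
  rewrite compm1 => /sdegen_sphere[sb sn _].
  apply/eP; split; last by exists (idm _); rewrite compm1; exact: esym sn.
  move=> i i_n.
  by rewrite [face A i ∘ _](sb i i_n); exact: basept_zero.
have [k kE] : exists k, e ∘ k = moore_incl saC A n.+1.
  have incl_zero (i : 'I_n.+2) :
      i <= n -> zero_morph (face A i ∘ moore_incl saC A n.+1).
    rewrite -ltnS => i_n; have -> : i = keep (Ordinal i_n) by apply: val_inj.
    exact: inter_ker_zero.
  apply/eP; split=> [i /ltnW /incl_zero //|].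
  have [z zz] := zero_morph_ex saC (moore_ob saC A n.+1) (Cyc A n).
  exists z; apply: (zero_morph_eq saC); first exact: zero_morphl.
  by apply: incl_zero; rewrite inordK.
exists u, v, s, k; split=> //; split.
- apply: (@cycle_simplex_mono n); rewrite compA uE -compA sE inord_keep.
  by rewrite compA face_degen_eq comp1m compm1.
- apply: (@cycle_simplex_mono n); rewrite compA vE -compA sE ord_max_next.
  by rewrite compA face_degen_eqS comp1m compm1.
- split.
    apply: (mono_zero_morph saC (@cycle_simplex_mono n)).
    rewrite compA uE -compA kE inord_keep.
    exact: (inter_ker_zero saC (fun i : 'I_n.+1 => face A (keep i))).
  move=> T g zug.
  have [i|h hE] := inter_ker_lift saC
    (f := fun i : 'I_n.+1 => face A (keep i)) (g := e ∘ g).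
    have [i_n|n_i] := ltnP i n; first by rewrite compA; apply/zero_morphr/e_zero.
    have -> : keep i = inord n.
      apply: val_inj; rewrite /= inordK //.
      by apply/eqP; rewrite eqn_leq n_i leq_ord.
    by rewrite compA -uE -compA; exact: zero_morphl.
  exists h; split; first by apply: emono; rewrite compA kE.
  move=> h' kh'; apply: (@moore_incl_mono _ saC A n.+1).
  by rewrite [LHS]hE -kh' compA kE.
- apply: (@cycle_simplex_mono n).
  by rewrite compA vE -compA kE -compA boundaryP moore_diffP.
Qed.

(** Homology is by definition the cokernel attached to the graph of homotopies,
    hence the quotient of the cycles by homotopy. *)
Lemma homology_proj_eq (epC : enough_projectives C) P (x : hom P (A 0)) n
    (z z' : hom P (Cyc A n)) :
  projective P -> zero_morph x ->
  homology_proj saC A n ∘ z = homology_proj saC A n ∘ z' <->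
  homot (x : simplex (hom_simplicial P A) 0)
    (cycle_simplex n ∘ z : simplex (hom_simplicial P A) n)
    (cycle_simplex n ∘ z').
Proof.
move=> pP zx.
have [E [e [u [v [s [k [eP uE vE [us vs keru vk]]]]]]]] := homotopy_graph_ex n.
have cokc : is_cokernel (v ∘ k) (homology_proj saC A n).
  by rewrite vk; exact: coker_morP.
rewrite (cokernel_reflexive_graph saC epC z z' us vs keru cokc pP).
split=> [[w [<- <-]]|[y [yb yn ymax]]].
  have [e_zero _] := (eP P (e ∘ w)).1 (ex_intro _ w erefl).
  exists (e ∘ w).
  split=> [i i_n||].
  - by apply: (zero_morph_eq saC); [exact: e_zero | exact: basept_zero].
  - by rewrite compA uE -compA.
  - by rewrite compA vE -compA.
have [|w ew] := (eP P y).2.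
  split; last by exists z.
  by move=> i i_n; rewrite [face A i ∘ y](yb i i_n); exact: basept_zero.
exists w; split; apply: (@cycle_simplex_mono n).
  by rewrite compA uE -compA ew; exact: yn.
by rewrite compA vE -compA ew; exact: ymax.
Qed.

End OneObject.

Section OneMap.
Variables (A B : simplicial C) (f : simplicial_map A B).
Hypothesis epC : enough_projectives C.

Lemma smapS_cycle_simplex P n (a : hom P (Cyc A n)) :
  smapS (hom_simplicial_map P f)
    (cycle_simplex A n ∘ a : simplex (hom_simplicial P A) n) =
  cycle_simplex B n ∘ (cycle_map saC f n ∘ a).
Proof.
have E : cycle_simplex B n ∘ cycle_map saC f n = f n ∘ cycle_simplex A n.
  by rewrite /cycle_simplex -compA cycle_mapP compA moore_mapP compA.
by rewrite compA E -compA.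
Qed.

(** As [Hom(P, _)] turns the projection from cycles to homology into a
    surjection, the [P]-elements of homology are the homotopy classes of
    [P]-spheres at zero; and enough projectives detect isomorphisms. *)
Lemma homology_map_isoP n :
  is_iso (homology_map saC f n) <->
  forall P, projective P -> forall x : hom P (A 0), zero_morph x ->
    homot_bijective (hom_simplicial_map P f) x n.
Proof.
have regA : regular_epi (homology_proj saC A n).
  by apply: (cokernel_regular_epi saC); exact: coker_morP.
have regB : regular_epi (homology_proj saC B n).
  by apply: (cokernel_regular_epi saC); exact: coker_morP.
split=> [[g [gh hg]] P pP x zx|bij].
  have zfx : zero_morph (f 0 ∘ x) by exact: zero_morphl.
  split=> [z z' /(sphere_zero _ zx)[a <-] /(sphere_zero _ zx)[a' <-]|w].
    rewrite !smapS_cycle_simplex.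
    move=> /(homology_proj_eq epC _ _ pP zfx) E.
    apply/(homology_proj_eq epC _ _ pP zx).
    rewrite -[_ ∘ a]comp1m -[_ ∘ a']comp1m -gh -!compA.
    by rewrite !(compA (homology_map _ _ _)) homology_mapP -!compA E.
  move=> /(sphere_zero _ zfx)[b <-].
  have [a aE] := pP _ _ _ regA (g ∘ (homology_proj saC B n ∘ b)).
  exists (cycle_simplex A n ∘ a); first exact: sphere_cycle.
  rewrite smapS_cycle_simplex.
  apply/(homology_proj_eq epC _ _ pP zfx).
  by rewrite compA -homology_mapP -compA aE compA hg comp1m.
have hmono : mono (homology_map saC f n).
  move=> T a b ab; have [P [e [pP re]]] := epC T.
  have [x zx] := zero_morph_ex saC P (A 0).
  have zfx : zero_morph (f 0 ∘ x) by exact: zero_morphl.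
  have [f_inj _] := bij P pP x zx.
  have [a' aE] := pP _ _ _ regA (a ∘ e); have [b' bE] := pP _ _ _ regA (b ∘ e).
  apply: (regular_epi_epi re); rewrite -aE -bE.
  apply/(homology_proj_eq epC _ _ pP zx).
  apply: f_inj; [exact: sphere_cycle | exact: sphere_cycle |].
  rewrite !smapS_cycle_simplex.
  apply/(homology_proj_eq epC _ _ pP zfx).
  by rewrite !compA -homology_mapP -!compA aE bE !compA ab.
have [P [e [pP re]]] := epC (homology saC B n).
have [x zx] := zero_morph_ex saC P (A 0).
have zfx : zero_morph (f 0 ∘ x) by exact: zero_morphl.
have [_ f_surj] := bij P pP x zx.
have [b bE] := pP _ _ _ regB e.
have [_ /(sphere_zero _ zx)[a <-]] := f_surj _ (sphere_cycle b zfx).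
rewrite smapS_cycle_simplex.
move=> /(homology_proj_eq epC _ _ pP zfx) E.
apply: (mono_regular_epi_factor_iso hmono (t := homology_proj saC A n ∘ a)).
by rewrite compA homology_mapP -compA E bE.
Qed.

End OneMap.
End HomologyElements.

Theorem theorem5p5 (C : category) (saC : semi_abelian C)
    (epC : enough_projectives C) (A B : simplicial C)
    (f : simplicial_map A B) :
  weak_equivalence f <-> homology_isomorphism saC f.
Proof.
have induces P n (x : simplex (hom_simplicial P A) 0) : projective P ->
    induces_iso (hom_simplicial_map P f) x n <->
    homot_bijective (hom_simplicial_map P f) x n.
  move=> pP; have [Q [_ [S]]] := subtraction_ex saC epC pP.
  by apply: induces_isoP; exact: (hom_homot_equivalence saC S).
split=> [weq n|iso P pP n x].
  apply/(homology_map_isoP saC f epC n) => P pP x zx.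
  by apply/induces => //; exact: weq.
apply/induces => //; have [Q [pQ [S]]] := subtraction_ex saC epC pP.
apply: (homot_bijective_retract saC (S := S)).
by apply: (homology_map_isoP saC f epC n).1 => //; exact: sub_self.
Qed.
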